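(* Let $k\geq1$ and let $\mathcal{U}$ be a union ultrafilter over $\mathbb{F}^k$. Then for every $(i,j)\in\{1,\dots,k\}^2$, $\widehat{\max}(\mathcal{U}(i))$ and $\widehat{\min}(\mathcal{U}(j))$ are P-points that are not nearly coherent to each other.
   Context: $\mathbb{F}^k$ is the set of functions $a\colon\mathrm{dom}(a)\to\{1,\dots,k\}$ with $\mathrm{dom}(a)\subseteq\omega$ finite and every colour $1,\dots,k$ attained. For blocks $a,b$ with disjoint domains, $a\cup b$ is their union as functions. For $X\subseteq\mathbb{F}^k$, $\mathrm{FU}(X)$ is the set of all finite unions of members of $X$ with pairwise disjoint domains. A union ultrafilter over $\mathbb{F}^k$ is a non-principal ultrafilter having a basis of sets of the form $\mathrm{FU}(X)$, $X\subseteq\mathbb{F}^k$. For an ultrafilter $\mathcal{U}$ over $\mathbb{F}^k$, $\widehat{\min}(\mathcal{U}(j))=\{X\subseteq\omega:\exists Y\in\mathcal{U}\ \{\min(y^{-1}[\{j\}]):y\in Y\}\subseteq X\}$ and $\widehat{\max}(\mathcal{U}(i))$ is defined analogously using $\max(y^{-1}[\{i\}])$. For a filter $\mathcal{B}$ and $f\colon\omega\to\omega$, $f(\mathcal{B})=\{X:f^{-1}[X]\in\mathcal{B}\}$; filters $\mathcal{F},\mathcal{G}$ are nearly coherent if for some finite-to-one $f$, $f(\mathcal{F})\cup f(\mathcal{G})$ generates a filter.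
   Formalization: The generating families X of a union ultrafilter are required to consist of blocks with pairwise disjoint domains (the standard definition); with arbitrary X the claim fails, e.g. for k=1 and a non-principal ultrafilter concentrating on blocks whose domain contains 0. *)

(* Defs.v *)
From mathcomp Require Import all_boot finmap.
From mathcomp Require Import boolp classical_sets cardinality filter.

Set Implicit Arguments.
Unset Strict Implicit.
Unset Printing Implicit Defensive.

Local Open Scope classical_set_scope.

(* The colours 1, ..., k are the elements of 'I_k. *)
Definition block (k : nat) : Type :=
  {a : {fmap nat -> 'I_k} | [forall c : 'I_k, c \in codomf a]}.

Definition block_map (k : nat) (a : block k) : {fmap nat -> 'I_k} := sval a.

Definition dom (k : nat) (a : block k) : {fset nat} := domf (block_map a).

Definition disjoint_dom (k : nat) (a b : block k) : bool :=
  [disjoint dom a & dom b]%fset.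

(* [catf] is right-biased, which is immaterial on disjoint domains. The empty *)
(* list contributes nothing when k >= 1: the empty map is not a block.        *)
Definition FU (k : nat) (X : set (block k)) : set (block k) :=
  [set a | exists s : seq (block k),
     [/\ forall b : block k, b \in s -> X b,
         pairwise (@disjoint_dom k) s &
         block_map a = foldr (fun b f => catf (block_map b) f) [fmap]%fmap s]].

Definition pairwise_disjoint (k : nat) (X : set (block k)) : Prop :=
  forall a b, X a -> X b -> a <> b -> disjoint_dom a b.

Definition nonprincipal (T : Type) (U : set_system T) : Prop :=
  forall x, U <> principal_filter x.

(* The generating families X consist of blocks with pairwise disjoint domains, *)
(* as for the classical union ultrafilters (k = 1). Without this, a family of  *)
(* blocks that all contain 0 satisfies FU X = X, and every nonprincipal        *)
(* ultrafilter concentrating on such blocks would qualify.                     *)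
Definition union_ultrafilter (k : nat) (U : set_system (block k)) : Prop :=
  [/\ UltraFilter U,
      nonprincipal U &
      forall Y, U Y -> exists X, [/\ pairwise_disjoint X, U (FU X) & FU X `<=` Y]].

Definition color_class (k : nat) (a : block k) (c : 'I_k) : pred nat :=
  fun n => fnd (block_map a) n == Some c.

Lemma color_class_neq0 (k : nat) (a : block k) (c : 'I_k) :
  exists n, color_class a c n.
Proof.
have /forallP /(_ c) /codomfP [n ac] := valP a.
by exists n; rewrite /color_class ac.
Qed.

Lemma color_class_bounded (k : nat) (a : block k) (c : 'I_k) n :
  color_class a c n -> n <= \max_(m <- dom a) m.
Proof.
rewrite /color_class /dom; case: fndP => // na _.
by apply: (@leq_bigmax_seq _ _ predT id n).
Qed.

Definition min_color (k : nat) (a : block k) (c : 'I_k) : nat :=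
  ex_minn (color_class_neq0 a c).

Definition max_color (k : nat) (a : block k) (c : 'I_k) : nat :=
  ex_maxn (color_class_neq0 a c) (@color_class_bounded k a c).

Definition min_hat (k : nat) (U : set_system (block k)) (j : 'I_k) :
    set_system nat :=
  [set X | exists2 Y, U Y & [set min_color y j | y in Y] `<=` X].

Definition max_hat (k : nat) (U : set_system (block k)) (i : 'I_k) :
    set_system nat :=
  [set X | exists2 Y, U Y & [set max_color y i | y in Y] `<=` X].

Definition P_point (V : set_system nat) : Prop :=
  [/\ UltraFilter V,
      nonprincipal V &
      forall A : nat -> set nat, (forall n, V (A n)) ->
        exists2 B, V B & forall n, finite_set (B `\` A n)].

Definition finite_to_one (f : nat -> nat) : Prop :=
  forall n, finite_set (f @^-1` [set n]).

Definition generates_filter (S : set_system nat) : Prop :=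
  ProperFilter (filter_from (finI_from S id) id).

(* [fmap f F] is the filter image [set X | F (f @^-1` X)]. *)
Definition nearly_coherent (F G : set_system nat) : Prop :=
  exists2 f : nat -> nat, finite_to_one f &
    generates_filter (filter.fmap f F `|` filter.fmap f G).

(* Main.v *)
Require Import Defs.
From mathcomp Require Import all_boot finmap.
From mathcomp Require Import boolp classical_sets cardinality filter.
From mathcomp Require Import zify.

(* Every element of a union ultrafilter [U] contains some [FU Y] on which a   *)
(* given two-colouring of the blocks is constant; each part of the theorem is *)
(* one well-chosen colouring. Below, "far" means "with large elements only".  *)
(*                                                                            *)
(* For a decreasing sequence [A n] of sets in the ultrafilter of maxima,      *)
(* colour a block by whether [max a \in A (min a)]; the negative case is      *)
(* refuted by adding to far blocks one fixed small block.                     *)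
(*                                                                            *)
(* For minima, colour a block by the parity of the number of elements [t]     *)
(* having some [s < t] in the block with [t \notin A s]. If [a] lies before   *)
(* [b], the counts of [a] and [b] add up in the union, plus one exactly when  *)
(* [min b \notin A (max a)]; hence on [FU Y] this last condition is decided   *)
(* once and for all, and it cannot hold since [A (max a)] is large.           *)
(*                                                                            *)
(* For near coherence, it suffices to separate [p (max_i a)] from             *)
(* [p (min_j b)] for monotone unbounded [p]. Fix [X] with [p min_j < p max_i] *)
(* on [FU X], decode [a \in FU X] as the set of its members [x \in X], and    *)
(* colour [a] by the parity of the number of values common to [p max_i] and   *)
(* [p min_j] on these members. The counts add up for [a] and a far [b], so    *)
(* they are even on [FU Y], whereas [p (max_i a) = p (min_j b)] creates       *)
(* exactly one new common value in the union of [a] and [b].                  *)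

Set Implicit Arguments.
Unset Strict Implicit.
Unset Printing Implicit Defensive.

Local Open Scope classical_set_scope.

(** Each part applies [homogeneous] to a colouring that can be controlled on the union of two
    members of [Y]. The union stays in [FU Y], so constancy of the colour decides the remaining
    unknown: in [odd_jumps_union], whether [min b] lies in [A (max a)]; in [odd_meetings_union],
    whether [p (max a) = p (min b)]. Members of [Y] as far out as desired exist by
    [union_ultrafilter_ge], which is where non-principality enters. A finite-to-one [f] reduces to
    monotone maps by [finite_to_one_interval]: the naturals are cut into intervals such that
    [f x = f y] puts [x] and [y] into equal or adjacent ones. Merging neighbouring intervals in
    pairs, in both possible ways, gives two monotone maps, and [max_min_separated] applied to both
    refutes near coherence. *)

Definition odd_card (A : set nat) : bool := odd #|` fset_set A|.

Lemma odd_cardU (A B : set nat) : finite_set A -> finite_set B ->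
  (forall n, A n -> B n -> False) ->
  odd_card (A `|` B) = odd_card A (+) odd_card B.
Proof.
move=> fA fB dAB; rewrite /odd_card fset_setU // -oddD -cardfsUI oddD.
rewrite -fset_setI //.
have -> : A `&` B = set0 by rewrite -subset0 => n [/dAB h /h].
by rewrite fset_set0 cardfs0 addbF.
Qed.

Lemma odd_card1 n : odd_card [set n].
Proof. by rewrite /odd_card fset_set1 cardfs1. Qed.

Lemma finite_set_ltn (A : set nat) N : (forall n, A n -> n < N) -> finite_set A.
Proof. by move=> AN; apply: sub_finite_set (finite_II N) => n /AN. Qed.

Lemma finite_set_ubound (A : set nat) :
  finite_set A -> exists N, forall n, A n -> n < N.
Proof.
move=> fA; exists (\max_(n <- fset_set A) n).+1 => n An; rewrite ltnS.
by apply: (@leq_bigmax_seq _ _ predT id n) => //; rewrite in_fset_set // inE.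
Qed.

(** * Images of ultrafilters, and P-points *)

Section UltrafilterImage.
Variables (T : Type) (U : set_system T) (g : T -> nat).
Hypothesis uU : UltraFilter U.

(** [max_hat U i] and [min_hat U j] are both instances, by conversion. *)
Definition image_filter : set_system nat :=
  [set X | exists2 Y, U Y & [set g y | y in Y] `<=` X].

Lemma image_filterE X : image_filter X <-> U (g @^-1` X).
Proof.
split=> [[Y UY YX]|UX]; last by exists (g @^-1` X) => // _ [y ? <-].
by apply: filterS UY => y Yy; apply: YX; exists y.
Qed.

Lemma image_ultrafilter : UltraFilter image_filter.
Proof.
have pU : ProperFilter image_filter.
  apply: Build_ProperFilter_ex => [X /image_filterE /filter_ex[y Xy]|].
    by exists (g y).
  split=> [|X Y /image_filterE UX /image_filterE UY|X Y XY /image_filterE UX].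
  - by apply/image_filterE; apply: filterT.
  - by apply/image_filterE; rewrite preimage_setI; apply: filterI.
  - by apply/image_filterE; apply: filterS UX => y; apply: XY.
split=> // G pG sG; apply/seteqP; split=> // X GX.
have [UX|UX] := in_ultra_setVsetC (g @^-1` X) uU; first exact/image_filterE.
have GC : G (~` X) by apply: sG; apply/image_filterE.
by have [n [Xn /(_ Xn)]] := filter_ex (filterI GX GC).
Qed.

Lemma image_nonprincipal :
  (forall n, U [set y | g y <> n]) -> nonprincipal image_filter.
Proof.
move=> freeU n E.
have : image_filter [set n] by rewrite E => m ->.
move/image_filterE => Un.
by have [y [/= yn /(_ yn)]] := filter_ex (filterI Un (freeU n)).
Qed.

End UltrafilterImage.

(** Replacing [A n] by the intersection of [A 0], ..., [A n] only enlarges the differences that must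
    be finite. *)
Lemma P_point_decreasing (V : set_system nat) : UltraFilter V -> nonprincipal V ->
  (forall A : nat -> set nat, (forall n, V (A n)) ->
     (forall m n, m <= n -> A n `<=` A m) ->
     exists2 B, V B & forall n, finite_set (B `\` A n)) ->
  P_point V.
Proof.
move=> uV npV h; split=> // A VA.
pose A' n := [set t | forall r, r <= n -> A r t].
have [|m n mn t At r rm|B VB fB] := h A'.
- elim=> [|n IH]; first by apply: filterS (VA 0) => t At r; rewrite leqn0 => /eqP->.
  apply: filterS (filterI IH (VA n.+1)) => t [A't At] r.
  by rewrite leq_eqVlt => /orP[/eqP->//|]; apply: A't.
- by apply: At; apply: leq_trans rm mn.
exists B => // n; apply: sub_finite_set (fB n) => t [Bt nAt]; split=> // A't.
by apply: nAt; apply: A't.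
Qed.

(** * Blocks and their finite unions *)

Section Blocks.
Variable k : nat.
Implicit Types (a b x y z : block k) (X Y : set (block k)) (c : 'I_k).

Lemma color_classP a c n : reflect (fnd (block_map a) n = Some c) (color_class a c n).
Proof. exact: eqP. Qed.

Lemma mem_dom a n : n \in dom a <-> exists c, color_class a c n.
Proof.
rewrite /dom /color_class; case: fndP => [na|nna]; split=> //.
- by move=> _; exists ((block_map a).[na])%fmap.
- by case.
Qed.

Lemma color_class_dom a c n : color_class a c n -> n \in dom a.
Proof. by move=> h; apply/mem_dom; exists c. Qed.

Lemma eq_block a b :
  (forall c n, color_class a c n <-> color_class b c n) -> a = b.
Proof.
move=> ab; apply: val_inj; apply/fmapP => n.
have {}ab c : fnd (block_map a) n = Some c <-> fnd (block_map b) n = Some c.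
  by split=> /color_classP /ab /color_classP.
rewrite -!/(block_map _).
case Ea: (fnd (block_map a) n) => [c|]; first by rewrite (proj1 (ab c)).
by case Eb: (fnd (block_map b) n) => [c|//]; rewrite -Ea; apply/ab.
Qed.

Lemma min_color_in a c : color_class a c (min_color a c).
Proof. by rewrite /min_color; case: ex_minnP. Qed.

Lemma min_color_le a c n : color_class a c n -> min_color a c <= n.
Proof. by rewrite /min_color; case: ex_minnP => m _; apply. Qed.

Lemma max_color_in a c : color_class a c (max_color a c).
Proof. by rewrite /max_color; case: ex_maxnP. Qed.

Lemma max_color_ge a c n : color_class a c n -> n <= max_color a c.
Proof. by rewrite /max_color; case: ex_maxnP => m _; apply. Qed.

Lemma min_color_le_max a c : min_color a c <= max_color a c.
Proof. exact/max_color_ge/min_color_in. Qed.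

Definition subblock x a := forall c n, color_class x c n -> color_class a c n.

(** Phrased by colour classes, hence symmetric in [a] and [b], unlike [catf]. *)
Definition union_of z a b :=
  forall c n, color_class z c n <-> color_class a c n \/ color_class b c n.

Lemma union_of_sub z a b : union_of z a b -> subblock a z /\ subblock b z.
Proof. by move=> zab; split=> c n h; apply/zab; [left|right]. Qed.

Lemma min_color_sub x a c : subblock x a -> min_color a c <= min_color x c.
Proof. by move=> xa; apply/min_color_le/xa/min_color_in. Qed.

Lemma max_color_sub x a c : subblock x a -> max_color x c <= max_color a c.
Proof. by move=> xa; apply/max_color_ge/xa/max_color_in. Qed.

Lemma min_color_union z a b c : union_of z a b ->
  min_color z c = minn (min_color a c) (min_color b c).
Proof.
move=> zab; have [az bz] := union_of_sub zab.
apply/eqP; rewrite eqn_leq leq_min !min_color_sub //.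
rewrite /= geq_min.
by have /zab[/min_color_le->//|/min_color_le->] := min_color_in z c; rewrite orbT.
Qed.

Lemma max_color_union z a b c : union_of z a b ->
  max_color z c = maxn (max_color a c) (max_color b c).
Proof.
move=> zab; have [az bz] := union_of_sub zab.
apply/eqP; rewrite eqn_leq geq_max !max_color_sub //.
rewrite andbT leq_max.
by have /zab[/max_color_ge->//|/max_color_ge->] := max_color_in z c; rewrite orbT.
Qed.

Lemma disjoint_domP a b n c d : disjoint_dom a b ->
  color_class a c n -> color_class b d n -> False.
Proof.
by move=> /fdisjointP ab /color_class_dom /ab /negP nb /color_class_dom /nb.
Qed.

Lemma fnd_union (s : seq (block k)) n c : pairwise (@disjoint_dom k) s ->
  fnd (foldr (fun b f => catf (block_map b) f) [fmap]%fmap s) n = Some c <->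
  exists2 b, b \in s & color_class b c n.
Proof.
move=> ds; elim: s ds c => [|b s IH] /=.
  by move=> _ c; rewrite fnd_fmap0; split=> // -[].
case/andP=> /allP bs /IH{}IH c; rewrite fnd_cat.
set f := foldr _ _ _ in IH *.
split.
  case: ifPn => [nf /IH[b' b's b'n]|nf bn].
    by exists b' => //; rewrite inE b's orbT.
  by exists b; [rewrite inE eqxx | apply/color_classP].
case=> b'; rewrite inE => /orP[/eqP->|b's] b'n.
  case: ifPn => [nf|_]; last exact/color_classP.
  exfalso; move: nf; rewrite -fndSome; case Ef: (fnd f n) => [d|//] _.
  by have /IH[b'' /bs bb'' b''n] := Ef; apply: (disjoint_domP bb'' b'n b''n).
have fn : fnd f n = Some c by apply/IH; exists b'.
by rewrite -fndSome fn.
Qed.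

Lemma FU_color_class X a c n : FU X a -> color_class a c n ->
  exists x, [/\ X x, subblock x a & color_class x c n].
Proof.
case=> s [sX ds Ea] /color_classP; rewrite Ea => /(fnd_union _ _ ds)[x xs xn].
exists x; split=> //; first exact: sX.
move=> d m xm; apply/color_classP; rewrite Ea.
by apply/(fnd_union _ _ ds); exists x.
Qed.

Lemma sub_FU X : X `<=` FU X.
Proof.
move=> x Xx; exists [:: x]; split=> //= [b|]; first by rewrite inE => /eqP->.
by apply/fmapP => n; rewrite fnd_cat in_fset0.
Qed.

Lemma FU_union X x y : pairwise_disjoint X -> X x -> X y -> x <> y ->
  exists2 z, FU X z & union_of z x y.
Proof.
move=> dX Xx Xy xy; pose s := [:: x; y].
have ds : pairwise (@disjoint_dom k) s by rewrite /= dX.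
pose f := foldr (fun b f => catf (block_map b) f) [fmap]%fmap s.
have fP : [forall c : 'I_k, c \in codomf f].
  apply/forallP => c; apply/codomfP; exists (min_color x c).
  by apply/(fnd_union _ _ ds); exists x; rewrite ?inE ?eqxx //; apply: min_color_in.
pose z : block k := exist _ f fP.
exists z.
  by exists s; split=> // b; rewrite !inE => /orP[]/eqP->.
move=> c n; split.
  move/color_classP => /(fnd_union _ _ ds)[b].
  by rewrite !inE => /orP[]/eqP->; [left|right].
move=> h; apply/color_classP/(fnd_union _ _ ds).
by case: h; [exists x|exists y]; rewrite // !inE eqxx ?orbT.
Qed.

Lemma pairwise_disjoint_eq X x y c d n : pairwise_disjoint X -> X x -> X y ->
  color_class x c n -> color_class y d n -> x = y.
Proof.
move=> dX Xx Xy xn yn; apply: contrapT => /(dX _ _ Xx Xy) xy.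
exact: disjoint_domP xy xn yn.
Qed.

(** By disjointness, a member of [X] that meets [a] is one of those composing [a]; this is what
    allows [a] to be decoded into members. *)
Lemma subblock_FU X a x c d n : pairwise_disjoint X -> FU X a -> X x ->
  color_class x c n -> color_class a d n -> subblock x a.
Proof.
move=> dX Xa Xx xn /(FU_color_class Xa)[y [Xy ya yn]].
by rewrite (pairwise_disjoint_eq dX Xx Xy xn yn).
Qed.

Lemma FU_min_color X a c : FU X a ->
  exists x, [/\ X x, subblock x a & min_color a c = min_color x c].
Proof.
move=> Xa; have [x [Xx xa xn]] := FU_color_class Xa (min_color_in a c).
exists x; split=> //; apply/eqP; rewrite eqn_leq.
by apply/andP; split; [apply: min_color_sub|apply: min_color_le].
Qed.

Lemma FU_max_color X a c : FU X a ->
  exists x, [/\ X x, subblock x a & max_color a c = max_color x c].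
Proof.
move=> Xa; have [x [Xx xa xn]] := FU_color_class Xa (max_color_in a c).
exists x; split=> //; apply/eqP; rewrite eqn_leq.
by apply/andP; split; [apply: max_color_ge|apply: max_color_sub].
Qed.

(** Members of [X] with the same minimum coincide, so only finitely many have their minimum below
    [n]. *)
Lemma max_color_bounded X c n : pairwise_disjoint X ->
  exists N, forall a, X a -> min_color a c < n -> max_color a c < N.
Proof.
move=> dX; elim: n => [|n [N IH]]; first by exists 0.
have [[b Xb bn]|nb] := pselect (exists2 b, X b & min_color b c = n).
  exists (maxn N (max_color b c).+1) => a Xa; rewrite ltnS leq_eqVlt leq_max.
  case/orP=> [/eqP an|/(IH a Xa)->//].
  suff -> : a = b by rewrite ltnSn orbT.
  apply: (@pairwise_disjoint_eq X a b c c n dX Xa Xb).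
    by rewrite -an min_color_in.
  by rewrite -bn min_color_in.
exists N => a Xa; rewrite ltnS leq_eqVlt => /orP[/eqP an|]; last exact: IH.
by case: nb; exists a.
Qed.


(** * Far blocks and homogeneous families *)

Section UnionUltrafilter.
Variable U : set_system (block k).
Hypothesis hU : union_ultrafilter U.

#[local] Instance uU : UltraFilter U. Proof. by case: hU. Qed.

(** Otherwise some [FU X] in [U] consists of blocks containing [n]; disjointness leaves a single
    member [x] in [X], so [FU X] is the singleton of [x] and [U] is principal. *)
Lemma union_ultrafilter_free n : U [set a | forall c, ~ color_class a c n].
Proof.
have [//|] := in_ultra_setVsetC [set a | forall c, ~ color_class a c n] uU.
have [_ npU basis] := hU; move=> /basis[X [dX UX XY]]; exfalso.
have {}XY a : FU X a -> exists c, color_class a c n.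
  by move=> /XY /existsNP[c /contrapT]; exists c.
have [a0 Xa0] := filter_ex UX; have [c a0n] := XY _ Xa0.
have [x [Xx xa xn]] := FU_color_class Xa0 a0n.
have xE y : X y -> y = x.
  by move=> Xy; have [d yn] := XY y (sub_FU Xy); apply: pairwise_disjoint_eq dX _ _ yn xn.
have aE a : FU X a -> a = x.
  move=> Xa; apply: eq_block => d m; split.
    by move=> /(FU_color_class Xa)[y [/xE-> _]].
  have [e an] := XY a Xa; have [y [/xE-> ya _]] := FU_color_class Xa an.
  exact: ya.
apply: (npU x); apply: (max_filter (UltraFilter := principal_filter_ultra x)).
move=> P Px; apply: filterS UX => a /aE->; exact: Px.
Qed.

Lemma union_ultrafilter_ge N : U [set a | forall c n, color_class a c n -> N <= n].
Proof.
elim: N => [|N IH]; first by apply: filterS filterT.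
apply: filterS (filterI IH (union_ultrafilter_free N)) => a [/= aN nN] c n an.
rewrite ltn_neqAle (aN _ _ an) andbT; apply/eqP => En.
by apply: (nN c); rewrite En.
Qed.

Lemma FU_far X N (c0 : 'I_k) : U (FU X) ->
  exists2 x, X x & forall c n, color_class x c n -> N <= n.
Proof.
move=> UX; have [a [Xa aN]] := filter_ex (filterI UX (union_ultrafilter_ge N)).
have [x [Xx xa _]] := FU_color_class Xa (min_color_in a c0).
by exists x => // c n /xa; apply: aN.
Qed.

Lemma homogeneous Z (P : set (block k)) : U Z -> exists Y,
  [/\ pairwise_disjoint Y, U (FU Y), FU Y `<=` Z & FU Y `<=` P \/ FU Y `<=` ~` P].
Proof.
move=> UZ; have [_ _ basis] := hU.
have [UP|UP] := in_ultra_setVsetC P uU.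
  have [Y [dY UY YZ]] := basis _ (filterI UZ UP).
  by exists Y; split=> //; [move=> a /YZ[] | left=> a /YZ[]].
have [Y [dY UY YZ]] := basis _ (filterI UZ UP).
by exists Y; split=> //; [move=> a /YZ[] | right=> a /YZ[]].
Qed.

(** * The maxima form a P-point *)

Lemma max_hat_P_point i : P_point (max_hat U i).
Proof.
have VE := @image_filterE _ U (fun a => max_color a i) uU.
apply: P_point_decreasing; first exact: image_ultrafilter.
  apply: image_nonprincipal => n.
  apply: filterS (union_ultrafilter_free n) => a an E.
  by apply: (an i); rewrite -E max_color_in.
move=> A VA decA.
have [Y [dY UY _ [Ypos|Yneg]]] :=
    homogeneous [set a | A (min_color a i) (max_color a i)] filterT.
  exists [set max_color a i | a in Y].
    exists (FU Y) => // _ [a /(FU_max_color i)[y [Yy _ ->]] <-].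
    by exists y.
  (* Once [min a >= n], the positive colour gives [max a] in [A (min a)], hence in [A n]; only
     finitely many members are left. *)
  move=> n; have [N YN] := max_color_bounded i n dY.
  apply: (@finite_set_ltn _ N) => _ [[a Ya <-] nA]; apply: YN => //.
  rewrite ltnNge; apply/negP => na; apply: nA.
  by apply: decA na _ _; apply/Ypos/sub_FU.
(* Joining the fixed [b] to a far [y] with [max y] in [A (min b)] keeps the maximum and brings the
   minimum down to at most [min b], so the union has the positive colour. *)
exfalso; have [b Yb _] := FU_far 0 i UY.
have /VE UA := VA (min_color b i).
have := filter_ex (filterI (filterI UA UY) (union_ultrafilter_ge (max_color b i).+1)).
case=> a [[/= Aa Ya] aN].
have [y [Yy ya Ey]] := FU_max_color i Ya; rewrite Ey in Aa.
have yb : max_color b i < max_color y i by rewrite -Ey; apply/(aN i)/max_color_in.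
have [|z Yz zyb] := FU_union dY Yy Yb; first by move=> E; rewrite E ltnn in yb.
apply: (Yneg z) => //=.
rewrite (max_color_union i zyb) (min_color_union i zyb) (maxn_idPl (ltnW yb)).
by apply: decA Aa; rewrite geq_minr.
Qed.

(** * The minima form a P-point *)

Definition jumps (A : nat -> set nat) j a :=
  [set t | color_class a j t /\ exists s, [/\ color_class a j s, s < t & ~ A s t]].

Lemma finite_jumps A j a : finite_set (jumps A j a).
Proof.
by apply: (@finite_set_ltn _ (max_color a j).+1) => t [/max_color_ge].
Qed.

(* When [a] precedes [b], only [min b] can become a jump: any later element of *)
(* [b] that jumps over some [s] in [a] already jumps over [min b].             *)
Lemma odd_jumps_union A j a b z : (forall m n, m <= n -> A n `<=` A m) ->
  union_of z a b -> max_color a j < min_color b j ->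
  odd_card (jumps A j z) =
    odd_card (jumps A j a) (+) odd_card (jumps A j b)
      (+) ~~ `[< A (max_color a j) (min_color b j) >].
Proof.
move=> decA zab ab.
have amx t : color_class a j t -> t <= max_color a j by apply: max_color_ge.
have bmn t : color_class b j t -> min_color b j <= t by apply: min_color_le.
have Jab : odd_card (jumps A j a `|` jumps A j b) =
    odd_card (jumps A j a) (+) odd_card (jumps A j b).
  apply: odd_cardU; [exact: finite_jumps|exact: finite_jumps|].
  by move=> t [/amx ta _] [/bmn tb _]; lia.
have sub : jumps A j a `|` jumps A j b `<=` jumps A j z.
  by move=> t [] [ht [s [hs st nA]]]; split; [|exists s; split| |exists s; split];
    rewrite // zab; [left|left|right|right].
have sup : jumps A j z `<=`
    jumps A j a `|` jumps A j b `|` [set t | t = min_color b j /\ ~ A (max_color a j) t].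
  move=> t [/zab[ta|tb] [s [/zab[sa|sb] st nA]]].
  - by left; left; split=> //; exists s.
  - by move: (amx _ ta) (bmn _ sb); lia.
  - have [E|tmn] := eqVneq t (min_color b j).
      right; split=> // At; apply: nA; exact: decA (amx _ sa) _ At.
    left; right; split=> //; exists (min_color b j); split.
    + exact: min_color_in.
    + by rewrite ltn_neqAle eq_sym tmn bmn.
    + by move=> At; apply: nA; apply: decA At; move: (amx _ sa); lia.
  - by left; right; split=> //; exists s.
case: asboolP => hA /=.
  rewrite addbF -Jab; congr odd_card; apply/seteqP; split=> // t /sup[//|[E nA]].
  by rewrite E in nA.
have -> : jumps A j z = (jumps A j a `|` jumps A j b) `|` [set min_color b j].
  apply/seteqP; split=> t.
    by move=> /sup[?|[? _]]; [left|right].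
  case=> [/sub//|->]; split; first by apply/zab; right; apply: min_color_in.
  by exists (max_color a j); split=> //; apply/zab; left; apply: max_color_in.
rewrite odd_cardU ?odd_card1 ?Jab //.
- by rewrite finite_setU; split; apply: finite_jumps.
- move=> t tJ E; case: tJ; rewrite E.
    by case=> /amx; lia.
  by case=> _ [s [/bmn]]; lia.
Qed.

Lemma min_hat_P_point j : P_point (min_hat U j).
Proof.
have VE := @image_filterE _ U (fun a => min_color a j) uU.
apply: P_point_decreasing; first exact: image_ultrafilter.
  apply: image_nonprincipal => n.
  apply: filterS (union_ultrafilter_free n) => a an E.
  by apply: (an j); rewrite -E min_color_in.
move=> A VA decA.
have [Y [dY UY _ hY]] := homogeneous [set a | odd_card (jumps A j a)] filterT.
have key a b : Y a -> Y b -> max_color a j < min_color b j ->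
    exists2 z, FU Y z & odd_card (jumps A j z) =
    odd_card (jumps A j a) (+) odd_card (jumps A j b)
      (+) ~~ `[< A (max_color a j) (min_color b j) >].
  move=> Ya Yb ab; have [|z Yz zab] := FU_union dY Ya Yb.
    by move=> E; move: ab (min_color_le_max b j); rewrite E; lia.
  by exists z => //; apply: odd_jumps_union.
case: hY => hY.
  exfalso; have [a Ya _] := FU_far 0 j UY.
  have /VE UA := VA (max_color a j).
  have := filter_ex (filterI (filterI UA UY) (union_ultrafilter_ge (max_color a j).+1)).
  case=> b [[/= Ab Yb] bN].
  have [y [Yy yb Ey]] := FU_min_color j Yb; rewrite Ey in Ab.
  have ay : max_color a j < min_color y j by rewrite -Ey; apply/(bN j)/min_color_in.
  have [z Yz] := key _ _ Ya Yy ay.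
  by rewrite (hY _ Yz) (hY _ (sub_FU Ya)) (hY _ (sub_FU Yy)) (asboolT Ab).
have {}hY a : FU Y a -> odd_card (jumps A j a) = false.
  by move=> /hY /negP /negbTE.
exists [set min_color a j | a in Y].
  exists (FU Y) => // _ [a /(FU_min_color j)[y [Yy _ ->]] <-].
  by exists y.
(* One member [a] beyond [n] suffices: every later [b] has [min b] in [A (max a)], which is
   contained in [A n]. *)
move=> n; have [a Ya an] := FU_far n j UY.
apply: (@finite_set_ltn _ (max_color a j).+1) => _ [[b Yb <-] nA].
rewrite ltnS leqNgt; apply/negP => ab; apply: nA.
have [z Yz] := key _ _ Ya Yb ab.
rewrite (hY _ Yz) (hY _ (sub_FU Ya)) (hY _ (sub_FU Yb)) /=.
case: asboolP => // Aab _; apply: decA Aab; apply: (an j); exact: max_color_in.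
Qed.

(** * Separating maxima from minima under a monotone unbounded map *)

Section Monotone.
Variables (p : nat -> nat) (i j : 'I_k).
Hypothesis p_mono : forall m n, m <= n -> p m <= p n.
Hypothesis p_unbounded : forall N, exists n, N < p n.

Local Notation M a := (p (max_color a i)).
Local Notation m a := (p (min_color a j)).

Lemma p_max_sub x a : subblock x a -> M x <= M a.
Proof. by move=> xa; apply/p_mono/max_color_sub. Qed.

Lemma p_min_sub x a : subblock x a -> m a <= m x.
Proof. by move=> xa; apply/p_mono/min_color_sub. Qed.

Lemma FU_far_p X N : U (FU X) ->
  exists2 x, X x & forall c n, color_class x c n -> N < p n.
Proof.
move=> UX; have [N' N'P] := p_unbounded N.
have [x Xx xN'] := FU_far N' i UX; exists x => // c n /xN' /p_mono.
exact: leq_trans.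
Qed.

(** The opposite colour is impossible: joining a far [b] to [a] raises [M] above [m a], while [m]
    does not grow. For [i] and [j] distinct the inequality can fail on single blocks. *)
Lemma separated_family : exists X,
  [/\ pairwise_disjoint X, U (FU X) & forall a, FU X a -> m a < M a].
Proof.
have [X [dX UX _ [hX|hX]]] := homogeneous [set a | m a < M a] filterT.
  by exists X.
exfalso; have [a Xa _] := FU_far 0 i UX.
have [b Xb bN] := FU_far_p (maxn (m a) (M a)) UX.
have hb : maxn (m a) (M a) < M b by apply: (bN i); apply: max_color_in.
have [|z Xz zab] := FU_union dX Xa Xb; first by move=> E; rewrite E in hb; lia.
have [az bz] := union_of_sub zab.
by apply: (hX z Xz) => /=; move: (p_min_sub az) (p_max_sub bz); lia.
Qed.

(** [x] and [y] may differ. Only members of [X] count, so that each of them lies in [a] or in [b]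
    when found in a union of the two. *)
Definition meetings X a := [set n : nat | exists x y,
  [/\ X x, X y, subblock x a, subblock y a & M x = n /\ m y = n]].

Lemma finite_meetings X a : finite_set (meetings X a).
Proof.
apply: (@finite_set_ltn _ (M a).+1) => _ [x [y [_ _ xa _ [<- _]]]].
exact: p_max_sub.
Qed.

Lemma subblock_union X x a b z : pairwise_disjoint X -> FU X a -> FU X b ->
  X x -> union_of z a b -> subblock x z -> subblock x a \/ subblock x b.
Proof.
move=> dX Xa Xb Xx zab xz; have xn := min_color_in x i.
have /zab[an|bn] := xz _ _ xn; [left|right].
  exact: subblock_FU dX Xa Xx xn an.
exact: subblock_FU dX Xb Xx xn bn.
Qed.

(** Meetings of [a] lie below [M a] and those of [b] above [m b], so they are disjoint. A mixed
    meeting with [x] in [a] and [y] in [b] satisfies [M x <= M a <= m b <= m y], which forces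
    equality throughout; with [x] in [b] and [y] in [a], [m y < M y <= M a <= m b <= m x < M x]
    excludes it. *)
Lemma odd_meetings_union X a b z : pairwise_disjoint X ->
  (forall x, X x -> m x < M x) -> FU X a -> FU X b -> union_of z a b ->
  M a <= m b ->
  odd_card (meetings X z) =
    odd_card (meetings X a) (+) odd_card (meetings X b) (+) (M a == m b).
Proof.
move=> dX sepX Xa Xb zab ab; have [az bz] := union_of_sub zab.
have ltA n : meetings X a n -> n < M a.
  case=> x [y [Xx Xy xa ya [_ <-]]].
  by apply: leq_trans (sepX _ Xy) (p_max_sub ya).
have gtB n : meetings X b n -> m b < n.
  case=> x [y [Xx Xy xb yb [<- _]]].
  by apply: leq_ltn_trans (p_min_sub xb) (sepX _ Xx).
have Jab : odd_card (meetings X a `|` meetings X b) =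
    odd_card (meetings X a) (+) odd_card (meetings X b).
  apply: odd_cardU; [exact: finite_meetings|exact: finite_meetings|].
  by move=> n /ltA ? /gtB ?; lia.
have sub : meetings X a `|` meetings X b `<=` meetings X z.
  move=> c [] [x [y [Xx Xy xs ys E]]]; exists x, y; split=> //.
  - by move=> d n /xs /az.
  - by move=> d n /ys /az.
  - by move=> d n /xs /bz.
  - by move=> d n /ys /bz.
have sup : meetings X z `<=`
    meetings X a `|` meetings X b `|` [set c | c = M a /\ M a = m b].
  move=> c [x [y [Xx Xy xz yz [Mx my]]]].
  have [xa|xb] := subblock_union dX Xa Xb Xx zab xz;
  have [ya|yb] := subblock_union dX Xa Xb Xy zab yz.
  - by left; left; exists x, y.
  - by right; move: (p_max_sub xa) (p_min_sub yb); rewrite /=; lia.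
  - by move: (p_min_sub xb) (sepX _ Xx) (sepX _ Xy) (p_max_sub ya); lia.
  - by left; right; exists x, y.
case: eqP => E.
  have -> : meetings X z = (meetings X a `|` meetings X b) `|` [set M a].
    apply/seteqP; split=> c.
      by move=> /sup[?|[? _]]; [left|right].
    case=> [/sub//|->].
    have [x [Xx xa Ex]] := FU_max_color i Xa.
    have [y [Xy yb Ey]] := FU_min_color j Xb.
    exists x, y; split=> //; first by move=> d n /xa /az.
      by move=> d n /yb /bz.
    by rewrite -Ex -Ey.
  rewrite odd_cardU ?odd_card1 ?Jab //.
    by rewrite finite_setU; split; apply: finite_meetings.
  by move=> n h En; rewrite En in h; case: h => [/ltA|/gtB]; lia.
by rewrite addbF -Jab; congr odd_card; apply/seteqP; split=> // c /sup[//|[]].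
Qed.

Lemma max_min_separated :
  exists2 A, U A & forall a b, A a -> A b -> M a <> m b.
Proof.
have [X [dX UX sepFX]] := separated_family.
have sepX x : X x -> m x < M x by move=> /sub_FU /sepFX.
have [Y [dY UY YX hY]] := homogeneous [set a | odd_card (meetings X a)] UX.
have key a b : Y a -> Y b -> M a <= m b ->
    exists2 z, FU Y z & odd_card (meetings X z) =
    odd_card (meetings X a) (+) odd_card (meetings X b) (+) (M a == m b).
  move=> Ya Yb ab; have Xa := YX _ (sub_FU Ya); have Xb := YX _ (sub_FU Yb).
  have [|z Yz zab] := FU_union dY Ya Yb.
    (* [a] and [b] are distinct, since [m a < M a] contradicts [M a <= m a]. *)
    by move=> E; move: ab (sepFX _ Xa); rewrite E; lia.
  by exists z => //; apply: odd_meetings_union.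
case: hY => hY.
  (* For [b] so far that [M a < m b] no new meeting arises, and the sum of two odd counts is
     even. *)
  exfalso; have [a Ya _] := FU_far 0 i UY.
  have [b Yb bN] := FU_far_p (M a) UY.
  have ab : M a < m b by apply: (bN j); apply: min_color_in.
  have [z Yz] := key _ _ Ya Yb (ltnW ab).
  by rewrite (hY _ Yz) (hY _ (sub_FU Ya)) (hY _ (sub_FU Yb)) ltn_eqF.
have {}hY a : FU Y a -> odd_card (meetings X a) = false.
  by move=> /hY /negP /negbTE.
exists (FU Y) => // a b /(FU_max_color i)[a' [Ya' _ Ea]].
move=> /(FU_min_color j)[b' [Yb' _ Eb]]; rewrite Ea Eb => E.
have [|z Yz] := key _ _ Ya' Yb'; first by rewrite E.
by rewrite (hY _ Yz) (hY _ (sub_FU Ya')) (hY _ (sub_FU Yb')) E eqxx.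
Qed.

End Monotone.

End UnionUltrafilter.
End Blocks.

(** * From finite-to-one to monotone maps, and the conclusion *)

Lemma finite_to_one_interval (f : nat -> nat) : finite_to_one f ->
  exists p : nat -> nat, [/\ forall m n, m <= n -> p m <= p n,
    forall N, exists n, N < p n &
    forall x y, f x = f y -> p y <= (p x).+1].
Proof.
move=> ff.
have stepP N : exists N', N < N' /\ forall x y, x < N -> f x = f y -> y < N'.
  elim: N => [|N [N' [NN' IH]]]; first by exists 1.
  have [L hL] := finite_set_ubound (ff (f N)).
  exists (maxn N'.+1 L); split=> [|x y]; first by lia.
  rewrite ltnS leq_eqVlt => /orP[/eqP-> fy|xN /(IH _ _ xN)]; last by lia.
  by have := hL y (esym fy); lia.
have [step hstep] := choice stepP.
(* The cut points: fibres of [f] meeting the numbers below [e n] stay below [e n.+1]. The map [p]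
   sends [t] to the least [n] with [t < e n], the index of its interval. *)
pose e n := iter n step 0.
have e_lt n : e n < e n.+1 by have [] := hstep (e n).
have e_mono m n : m <= n -> e m <= e n.
  by move=> /subnK<-; elim: (n - m) => // d /leq_trans; apply; apply/ltnW/e_lt.
have e_ge n : n <= e n by elim: n => // n IH; apply: leq_ltn_trans IH (e_lt n).
have ex t : exists n, t < e n by exists t.+1; apply: e_ge.
pose p t := ex_minn (ex t).
have p_lt t : t < e (p t) by rewrite /p; case: ex_minnP.
have p_le t n : t < e n -> p t <= n by rewrite /p; case: ex_minnP => ? _; apply.
exists p; split=> [s t st|N|x y fxy].
- by apply: p_le; apply: leq_ltn_trans st (p_lt t).
- exists (e N); rewrite ltnNge; apply/negP => /e_mono.
  by rewrite leqNgt p_lt.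
- by apply: p_le; have [_ h] := hstep (e (p x)); apply: h (p_lt x) fxy.
Qed.

Theorem theorem2p16 (k : nat) (hk : 1 <= k) (U : set_system (block k))
    (hU : union_ultrafilter U) (i j : 'I_k) :
  [/\ P_point (max_hat U i),
      P_point (min_hat U j) &
      ~ nearly_coherent (max_hat U i) (min_hat U j)].
Proof.
have uU : UltraFilter U by case: hU.
split; [exact: max_hat_P_point|exact: min_hat_P_point|].
case=> f ff gF.
have [p [p_mono p_unb p_f]] := finite_to_one_interval ff.
(* Two values of [p] at distance at most 1 agree under [half] or [uphalf]. *)
have [||A0 UA0 sep0] :=
  max_min_separated hU i j (p := fun n => uphalf (p n)).
- by move=> m n /p_mono; lia.
- by move=> N; have [n] := p_unb N.*2; exists n; lia.
have [||A1 UA1 sep1] :=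
  max_min_separated hU i j (p := fun n => (p n)./2).
- by move=> m n /p_mono; lia.
- by move=> N; have [n] := p_unb N.*2.+1; exists n; lia.
have UA : U (A0 `&` A1) by apply: filterI.
pose S := filter.fmap f (max_hat U i) `|` filter.fmap f (min_hat U j).
pose E1 := f @` [set max_color a i | a in A0 `&` A1].
pose E2 := f @` [set min_color a j | a in A0 `&` A1].
have S1 : S E1.
  left; exists (A0 `&` A1) => // _ [a Aa <-].
  by exists (max_color a i) => //; exists a.
have S2 : S E2.
  right; exists (A0 `&` A1) => // _ [a Aa <-].
  by exists (min_color a j) => //; exists a.
(* A proper filter makes [E1] and [E2] meet, giving [a] and [b] in both separating sets with
   [f (max a) = f (min b)]. *)
have SE : filter_from (finI_from S id) id (E1 `&` E2).
  by exists (E1 `&` E2) => //; apply: finI_fromI; apply: (finI_from1 id).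
have [_ [[_ [a [A0a A1a] <-] <-] [_ [b [A0b A1b] <-] Eab]]] := filter_ex (FF := gF) SE.
have := sep0 _ _ A0a A0b; have := sep1 _ _ A1a A1b.
by have := p_f _ _ Eab; have := p_f _ _ (esym Eab); lia.
Qed.
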